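(* Let $\Omega$ be an open subset of $\mathbb{C}$, let $f$ be a non-constant analytic function defined in $\Omega$, and let $z_0=x_0+iy_0\in\Omega$, with $x_0$ and $y_0$ real numbers. Then $(x_0,y_0)$ is a saddle point of $F=|f|:\Omega\to\mathbb{R}$ if and only if $f'(z_0)=0$ and $f(z_0)\neq 0$.
   Context: A function $f:\Omega\to\mathbb{C}$, with $\Omega\subset\mathbb{C}$ open, is analytic in $\Omega$ if for each $w\in\Omega$ there exist a radius $r=r(w)>0$ and constants $c_n\in\mathbb{C}$ such that the open disk $D(w;r)=\{z\in\mathbb{C}:|z-w|<r\}$ is contained in $\Omega$ and $f(z)=\sum_{n=0}^{+\infty}c_n(z-w)^n$ for all $z\in D(w;r)$. The set $\Omega$ is identified with the subset $\{(x,y)\in\mathbb{R}^2: x+iy\in\Omega\}$ of $\mathbb{R}^2$. Given a real-differentiable function $F:\Omega\to\mathbb{R}$, with $\Omega$ an open subset of $\mathbb{R}^2$, a point $P_0\in\Omega$ is a saddle point of $F$ if $P_0$ is a critical point of $F$ (i.e., the first-order partial derivatives $F_x(P_0)$ and $F_y(P_0)$ are both zero) but $P_0$ is not a local extremum of $F$ (i.e., $P_0$ is neither a point of local maximum of $F$ nor a point of local minimum of $F$).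
   Formalization: ''Non-constant'' is required on the connected component of Ω containing z₀ (the same as non-constant on Ω when Ω is connected); for disconnected Ω the claim fails, e.g. f=1 on D(0;1), f(z)=z on D(5;1), z₀=0. *)

(* Defs.v *)
From Stdlib Require Import Reals.
From Coquelicot Require Import Coquelicot.

(* Coquelicot's [C] is [R * R] by definition, so a subset of [C] is literally
   a subset of the plane and no coercion between the two is needed.
   A function defined on [Omega] is a total function of which only the values
   on [Omega] are ever constrained or used. *)

Definition disk (w : C) (r : R) (z : C) : Prop := Cmod (z - w)%C < r.

Definition analytic_on (Omega : C -> Prop) (f : C -> C) : Prop :=
  forall w : C, Omega w ->
    exists (r : R) (c : nat -> C),
      0 < r /\
      (forall z : C, disk w r z -> Omega z) /\
      (forall z : C, disk w r z ->
         is_pseries (K := C_AbsRing) (V := C_NormedModule) c (z - w)%C (f z)).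

Definition is_critical_point (F : R * R -> R) (P0 : R * R) : Prop :=
  is_derive (fun x : R => F (x, snd P0)) (fst P0) 0 /\
  is_derive (fun y : R => F (fst P0, y)) (snd P0) 0.

Definition is_local_max (Omega : R * R -> Prop) (F : R * R -> R) (P0 : R * R)
  : Prop :=
  within Omega (locally P0) (fun P => F P <= F P0).

Definition is_local_min (Omega : R * R -> Prop) (F : R * R -> R) (P0 : R * R)
  : Prop :=
  within Omega (locally P0) (fun P => F P0 <= F P).

(* Differentiability of [F] on the whole of [Omega] is not required: a modulus
   [|f|] is not differentiable at the simple zeros of [f].  Only the existence
   of the two partial derivatives at [P0] is, through [is_critical_point]. *)
Definition is_saddle_point (Omega : R * R -> Prop) (F : R * R -> R)
  (P0 : R * R) : Prop :=
  Omega P0 /\ is_critical_point F P0 /\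
  ~ (is_local_max Omega F P0 \/ is_local_min Omega F P0).

Definition connected_set (A : C -> Prop) : Prop :=
  forall U V : C -> Prop, open U -> open V ->
    (forall z, A z -> U z \/ V z) ->
    (exists z, A z /\ U z) -> (exists z, A z /\ V z) ->
    exists z, A z /\ U z /\ V z.

Definition connected_component (Omega : C -> Prop) (z w : C) : Prop :=
  exists A : C -> Prop,
    connected_set A /\ (forall u, A u -> Omega u) /\ A z /\ A w.

Definition nonconstant_on (A : C -> Prop) (f : C -> C) : Prop :=
  exists w1 w2 : C, A w1 /\ A w2 /\ f w1 <> f w2.

(* For [Omega] connected, being non-constant on the component of a point of
   [Omega] is just being non-constant on [Omega]. *)
Lemma nonconstant_on_component_connected (Omega : C -> Prop) (f : C -> C)
  (z0 : C) : connected_set Omega -> Omega z0 ->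
  (nonconstant_on (connected_component Omega z0) f <-> nonconstant_on Omega f).
Proof.
intros HO Hz0; split; intros (w1 & w2 & H1 & H2 & H12); exists w1, w2.
- destruct H1 as (A1 & _ & S1 & _ & I1), H2 as (A2 & _ & S2 & _ & I2).
  now repeat split; auto.
- now repeat split; auto; exists Omega; repeat split; auto.
Qed.

(* Main.v *)
Require Import Defs.
From Stdlib Require Import Reals Lra Lia Classical Wf_nat.
From Coquelicot Require Import Coquelicot.

(** Near [z0] the function is [f z0 + b * (z - z0) ^ m + O((z - z0) ^ (m + 1))]
    with [b <> 0] and [m >= 1], unless it is constant there
    ([analytic_normal_form]); the latter would make it constant on the whole
    connected component of [z0], by the identity theorem
    ([locally_constant_component]).

    Since [b * (z - z0) ^ m] takes every direction, the values of [f] near [z0]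
    include points pushed from [f z0] away from the origin and points pulled
    towards it ([values_in_every_direction]). So, when [f z0 <> 0], the modulus
    has neither a local maximum nor a local minimum at [z0]
    ([modulus_not_extremal]); when [f z0 = 0], it has an obvious minimum.

    What remains is that, when [f z0 <> 0], the point [z0] is critical for [|f|]
    exactly when [f'(z0) = 0] ([critical_point_modulus]): the gradient of
    [|f|^2 / 2] has as coordinates the inner products of [f z0] with [f'(z0)]
    and with [i * f'(z0)], two orthogonal vectors of the same length. *)

Open Scope R_scope.

(** * Power series near their centre *)

Lemma pow_n_Cpow (z : C) (n : nat) : pow_n (K := C_Ring) z n = (z ^ n)%C.
Proof. induction n as [|n IH]; [reflexivity|]. simpl. rewrite IH. reflexivity. Qed.

(** A geometric series of ratio at most 1/2 sums to at most twice its first term,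
    which here is the bound on the term of index [m + 1]. The factor [1 - (1/2)^k] is there to make the induction on [k] go through. *)
Lemma geometric_tail_bound (a : nat -> C) (M t : R) (m k : nat) :
  0 <= t <= / 2 -> (forall n, Cmod (a n) <= M * t ^ n) ->
  (forall n, (n < m)%nat -> a n = 0%C) ->
  Cmod (sum_n (G := C_AbelianMonoid) a (m + k) - a m)%C
    <= 2 * M * t ^ S m * (1 - (/ 2) ^ k).
Proof.
intros Ht HM Ha.
assert (M0 : 0 <= M).
{ generalize (HM O) (Cmod_ge_0 (a O)); simpl; lra. }
induction k as [|k IH].
- replace (sum_n (G := C_AbelianMonoid) a (m + 0)) with (a m).
  + replace (a m - a m)%C with (RtoC 0) by ring.
    rewrite Cmod_0; simpl; lra.
  + rewrite Nat.add_0_r. destruct m as [|m].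
    * now rewrite sum_O.
    * rewrite sum_Sn, (sum_n_ext_loc _ (fun _ => zero)).
      -- unfold sum_n; rewrite sum_n_m_const_zero. now rewrite plus_zero_l.
      -- intros n Hn. apply Ha. lia.
- rewrite Nat.add_succ_r, sum_Sn.
  change plus with Cplus.
  replace (sum_n (G := C_AbelianMonoid) a (m + k) + a (S (m + k)) - a m)%C
    with ((sum_n (G := C_AbelianMonoid) a (m + k) - a m) + a (S (m + k)))%C by ring.
  eapply Rle_trans; [apply Cmod_triangle|].
  assert (E : t ^ k <= (/ 2) ^ k) by (apply pow_incr; exact Ht).
  assert (P : 0 <= M * t ^ S m) by (apply Rmult_le_pos; [lra|apply pow_le; lra]).
  generalize (HM (S (m + k))); intros H1.
  replace (S (m + k)) with (S m + k)%nat in H1 by lia.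
  rewrite pow_add in H1.
  assert (H2 := Rmult_le_compat_l _ _ _ P E).
  change (S (m + k)) with (S m + k)%nat.
  replace ((/ 2) ^ S k) with (/ 2 * (/ 2) ^ k) by reflexivity.
  nra.
Qed.

Lemma is_pseries_value_unique (K : AbsRing) (V : NormedModule K)
  (a : nat -> V) (x : K) (l l' : V) :
  is_pseries a x l -> is_pseries a x l' -> l = l'.
Proof. apply filterlim_locally_unique. Qed.

(** Convergence at the point [r / 2] bounds the coefficients geometrically, and
    within half of that distance the tail is at most the sum of a geometric
    series of ratio 1/2. The one estimate stands both for the factorisation
    [h ^ m * (c m + O(h))] and for a Taylor expansion. *)
Lemma power_series_leading_term (c : nat -> C) (F : C -> C) (r : R) (m : nat) :
  0 < r ->
  (forall h, Cmod h < r ->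
     is_pseries (K := C_AbsRing) (V := C_NormedModule) c h (F h)) ->
  (forall n, (n < m)%nat -> c n = 0%C) ->
  exists K d, 0 < K /\ 0 < d <= r /\
    forall h, Cmod h < d -> Cmod (F h - c m * h ^ m)%C <= K * Cmod h ^ S m.
Proof.
intros Hr HF Hc.
set (p := r / 2).
assert (p0 : 0 < p) by (unfold p; lra).
assert (HB : exists M, forall n, Cmod (c n) * p ^ n <= M).
{ assert (Hp : Cmod (RtoC p) < r).
  { rewrite Cmod_R, Rabs_right; unfold p; lra. }
  destruct (filterlim_bounded (K := C_AbsRing) (V := C_NormedModule) _
              (ex_intro _ _ (HF _ Hp))) as [M HM].
  set (v := fun n => scal (K := C_AbsRing) (V := C_NormedModule) (pow_n (RtoC p) n) (c n) : C).
  assert (HM' : forall n, Cmod (sum_n (G := C_AbelianMonoid) v n) <= M).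
  { exact HM. }
  exists (2 * M). intros n.
  assert (E : v n = (c n * RtoC p ^ n)%C).
  { unfold v; rewrite pow_n_Cpow. apply Cmult_comm. }
  assert (Q : Cmod (c n) * p ^ n = Cmod (c n * RtoC p ^ n)%C).
  { rewrite Cmod_mult, Cmod_pow, Cmod_R, (Rabs_right p) by lra. reflexivity. }
  rewrite Q, <- E.
  destruct n as [|n].
  - generalize (HM' O) (Cmod_ge_0 (v O)). rewrite sum_O. lra.
  - generalize (HM' (S n)) (HM' n). rewrite sum_Sn.
    set (u := sum_n _ n).
    change (plus u (v (S n))) with (u + v (S n))%C. intros H1 H2.
    replace (v (S n)) with ((u + v (S n)) + - u)%C by ring.
    eapply Rle_trans; [apply Cmod_triangle|]. rewrite Cmod_opp. lra. }
destruct HB as [M HM].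
assert (M0 : 0 <= M).
{ generalize (HM O) (Cmod_ge_0 (c O)); simpl; lra. }
assert (pm : 0 < p ^ S m) by now apply pow_lt.
(* the added 1 keeps the constant positive when all the coefficients vanish *)
exists (2 * M / p ^ S m + 1), (p / 2). split; [|split].
- assert (0 <= 2 * M / p ^ S m); [|lra].
  apply Rmult_le_pos; [lra|]. left; now apply Rinv_0_lt_compat.
- unfold p; lra.
- intros h Hh.
  assert (Hhr : Cmod h < r) by (unfold p in *; lra).
  set (t := Cmod h / p).
  assert (Ht : 0 <= t <= / 2).
  { unfold t; split.
    - apply Rmult_le_pos; [apply Cmod_ge_0|left; now apply Rinv_0_lt_compat].
    - apply Rmult_le_reg_r with p; [lra|].
      unfold Rdiv; rewrite Rmult_assoc, Rinv_l by lra. lra. }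
  set (a := fun n => scal (pow_n (K := C_Ring) h n) (c n) : C).
  assert (Ea : forall n, a n = (c n * h ^ n)%C).
  { intros n; unfold a; rewrite pow_n_Cpow; apply Cmult_comm. }
  assert (Hpart : forall k, Cmod (sum_n (G := C_AbelianMonoid) a (m + k) - a m)%C
                              <= 2 * M * t ^ S m).
  { intros k.
    eapply Rle_trans.
    - apply geometric_tail_bound with (1 := Ht).
      + intros n. rewrite Ea, Cmod_mult, Cmod_pow.
        unfold t, Rdiv; rewrite Rpow_mult_distr, pow_inv.
        assert (pn : 0 < p ^ n) by now apply pow_lt.
        apply Rmult_le_reg_r with (p ^ n); [lra|].
        replace (M * (Cmod h ^ n * / p ^ n) * p ^ n) with (M * Cmod h ^ n)
          by (field; lra).
        generalize (HM n) (pow_le _ n (Cmod_ge_0 h)). nra.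
      + intros n Hn. rewrite Ea, Hc by exact Hn. ring.
    - assert (0 <= (/ 2) ^ k) by (apply pow_le; lra).
      assert (0 <= M * t ^ S m) by (apply Rmult_le_pos; [lra|apply pow_le; lra]).
      nra. }
  assert (T : 2 * M * t ^ S m = 2 * M / p ^ S m * Cmod h ^ S m).
  { unfold t, Rdiv; rewrite Rpow_mult_distr, pow_inv. ring. }
  rewrite T in Hpart. clear T.
  rewrite <- Ea.
  apply Rle_trans with (2 * M / p ^ S m * Cmod h ^ S m).
  2: { generalize (pow_le _ (S m) (Cmod_ge_0 h)). lra. }
  (* the bound on the partial sums passes to the limit *)
  apply le_epsilon. intros e He.
  generalize (HF h Hhr). intros HS.
  destruct (proj1 (filterlim_locally_ball_norm (K := C_AbsRing) (U := C_NormedModule)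
                     _ _) HS (mkposreal e He)) as [N HN].
  generalize (HN (m + N)%nat ltac:(lia)) (Hpart N).
  unfold ball_norm.
  set (s := sum_n (G := C_AbelianMonoid) a (m + N)).
  change (Cmod (s - F h)%C < e -> Cmod (s - a m)%C <= 2 * M / p ^ S m * Cmod h ^ S m ->
    Cmod (F h - a m)%C <= 2 * M / p ^ S m * Cmod h ^ S m + e). intros H1 H2.
  replace (F h - a m)%C with ((s - a m) + - (s - F h))%C by ring.
  eapply Rle_trans; [apply Cmod_triangle|]. rewrite Cmod_opp. lra.
Qed.

(** The local dichotomy behind the whole proof: either all the coefficients of
    [f - a] at [w] vanish, or one of them is the first that does not. *)
Lemma analytic_normal_form (Omega : C -> Prop) (f : C -> C) (w a : C) :
  analytic_on Omega f -> Omega w ->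
  exists d, 0 < d /\ (forall z, disk w d z -> Omega z) /\
    ((forall z, disk w d z -> f z = a) \/
     exists (m : nat) (b : C) (K : R), b <> 0%C /\ 0 < K /\
       forall z, disk w d z ->
         Cmod (f z - a - b * (z - w) ^ m)%C <= K * Cmod (z - w)%C ^ S m).
Proof.
intros Hf Hw.
destruct (Hf w Hw) as (r & c & Hr & HO & HS).
set (c' := fun n => match n with O => (c O - a)%C | _ => c n end).
assert (HS' : forall h, Cmod h < r ->
  is_pseries (K := C_AbsRing) (V := C_NormedModule) c' h (f (w + h) - a)%C).
{ intros h Hh.
  assert (E : (w + h - w)%C = h) by ring.
  generalize (HS (w + h)%C). unfold disk. rewrite E. intros H.
  specialize (H Hh).
  assert (Z : is_pseries (K := C_AbsRing) (V := C_NormedModule)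
                (fun n => match n with O => Copp a | _ => RtoC 0 end : C) h (- a)%C).
  { unfold is_pseries, is_series.
    apply filterlim_ext with (fun _ : nat => (- a)%C); [|apply filterlim_const].
    intros n; induction n as [|n IH].
    - rewrite sum_O. simpl. symmetry. apply (scal_one (K := C_AbsRing) (V := C_NormedModule)).
    - rewrite sum_Sn, <- IH.
      rewrite (scal_zero_r (K := C_AbsRing) (V := C_NormedModule)).
      symmetry; apply (plus_zero_r (G := C_AbelianMonoid)). }
  generalize (is_pseries_plus _ _ _ _ _ H Z). unfold is_pseries.
  apply is_series_ext. intros [|n]; simpl; [reflexivity|].
  unfold PS_plus. f_equal. apply (plus_zero_r (G := C_AbelianMonoid)). }
destruct (classic (exists n, c' n <> 0%C)) as [Hn|Hn].
- destruct (dec_inh_nat_subset_has_unique_least_element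
              (fun n => c' n <> 0%C)) as (m & [Hm Hmin] & _).
  { intros n; apply classic. }
  { exact Hn. }
  destruct (power_series_leading_term c' (fun h => f (w + h) - a)%C r m Hr HS')
    as (K & d & HK & [Hd Hdr] & HB).
  { intros n Hlt. apply NNPP. intros H. generalize (Hmin n H). lia. }
  exists d. split; [exact Hd|]. split.
  { intros z Hz; apply HO; unfold disk in *; lra. }
  right. exists m, (c' m), K. split; [exact Hm|]. split; [exact HK|].
  intros z Hz. generalize (HB (z - w)%C Hz).
  now replace (w + (z - w))%C with z by ring.
- exists r. split; [exact Hr|]. split; [exact HO|]. left.
  intros z Hz.
  generalize (HS' (z - w)%C Hz).
  replace (w + (z - w))%C with z by ring. intros H.
  assert (H0 : is_pseries (K := C_AbsRing) (V := C_NormedModule) c' (z - w)%C (RtoC 0)).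
  { unfold is_pseries, is_series.
    apply filterlim_ext with (fun _ : nat => RtoC 0); [|apply filterlim_const].
    assert (E : forall n, c' n = 0%C).
    { intros n; apply NNPP; intros Hc; apply Hn; now exists n. }
    intros n; induction n as [|n IH].
    - rewrite sum_O, E. symmetry. apply (scal_zero_r (K := C_AbsRing) (V := C_NormedModule)).
    - rewrite sum_Sn, <- IH, E.
      rewrite (scal_zero_r (K := C_AbsRing) (V := C_NormedModule)).
      symmetry; apply (plus_zero_r (G := C_AbelianMonoid)). }
  assert (E : (f z - a)%C = 0%C).
  { exact (is_pseries_value_unique C_AbsRing C_NormedModule _ _ _ _ H H0). }
  replace (f z) with ((f z - a) + a)%C by ring. rewrite E. ring.
Qed.

(** * The identity theorem on a connected component *)

(** Neighbourhoods of the plane are made of squares; Euclidean disks generate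
    the same ones. *)
Lemma locally_disk (w : C) (P : C -> Prop) :
  locally (T := C_UniformSpace) w P <->
  exists d, 0 < d /\ forall z, disk w d z -> P z.
Proof.
split.
- intros [e He]. exists e. split; [apply cond_pos|]. intros z Hz.
  apply He. now apply C_NormedModule_mixin_compat1.
- intros (d & Hd & H).
  assert (Hd2 : 0 < d / 2) by lra.
  exists (mkposreal _ Hd2). intros z Hz. apply H.
  eapply Rlt_le_trans; [exact (C_NormedModule_mixin_compat2 _ _ _ Hz)|].
  simpl. assert (sqrt 2 < 2).
  { rewrite <- (sqrt_Rsqr 2) at 2 by lra. apply sqrt_lt_1; unfold Rsqr; lra. }
  nra.
Qed.

(** A value close to its leading term [b * h ^ m] cannot vanish: this isolates
    the points where a non-constant analytic function takes a given value. *)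
Lemma leading_term_nonzero (m : nat) (b h v : C) (K : R) :
  0 < K -> h <> 0%C -> Cmod h < Cmod b / K ->
  Cmod (v - b * h ^ m)%C <= K * Cmod h ^ S m -> v <> 0%C.
Proof.
intros HK Hh Hlt Hv E. subst v.
replace (0 - b * h ^ m)%C with (- (b * h ^ m))%C in Hv by ring.
rewrite Cmod_opp, Cmod_mult, Cmod_pow in Hv. simpl in Hv.
assert (P : 0 < Cmod h ^ m) by (apply pow_lt, Cmod_gt_0, Hh).
assert (Q : Cmod h * K < Cmod b).
{ apply Rmult_lt_compat_r with (r := K) in Hlt; [|exact HK].
  unfold Rdiv in Hlt; rewrite Rmult_assoc, Rinv_l in Hlt; lra. }
nra.
Qed.

(** The points near which [f] is constantly [a], and the points around which [f]
    avoids [a] (the centre excepted), form two disjoint open sets that cover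
    [Omega]. A connected set through [z0] therefore stays in the first one. *)
Lemma locally_constant_component (Omega : C -> Prop) (f : C -> C) (z0 a : C) :
  analytic_on Omega f ->
  (exists d, 0 < d /\ forall z, disk z0 d z -> f z = a) ->
  forall w, connected_component Omega z0 w -> f w = a.
Proof.
intros Hf H0 w (A & HA & HAO & Az0 & Aw).
set (U := fun z => exists d, 0 < d /\ forall z', disk z d z' -> f z' = a).
set (V := fun z => exists d, 0 < d /\
            forall z', disk z d z' -> z' <> z -> f z' <> a).
assert (disk_center : forall z d, 0 < d -> disk z d z).
{ intros z d Hd. unfold disk. replace (z - z)%C with (RtoC 0) by ring.
  now rewrite Cmod_0. }
assert (sub_disk : forall z d z', disk z d z' ->
          exists e, 0 < e /\ forall u, disk z' e u -> disk z d u).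
{ unfold disk; intros z d z' Hz'. exists (d - Cmod (z' - z)%C). split; [lra|].
  intros u Hu. replace (u - z)%C with ((u - z') + (z' - z))%C by ring.
  eapply Rle_lt_trans; [apply Cmod_triangle|]. lra. }
assert (UV : forall z, U z -> V z -> False).
{ intros z (d & Hd & H1) (e & He & H2).
  (* a point other than z at which both descriptions would have to hold *)
  set (t := Rmin d e / 2).
  assert (Ht : 0 < t /\ t < d /\ t < e).
  { unfold t. generalize (Rmin_l d e) (Rmin_r d e) (Rmin_pos d e Hd He). lra. }
  assert (E : Cmod (z + RtoC t - z)%C = t).
  { replace (z + RtoC t - z)%C with (RtoC t) by ring.
    rewrite Cmod_R, Rabs_right; lra. }
  apply (H2 (z + RtoC t)%C).
  - unfold disk; lra.
  - intros Eq. rewrite Eq in E. replace (z - z)%C with (RtoC 0) in E by ring.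
    rewrite Cmod_0 in E. lra.
  - apply H1. unfold disk; lra. }
assert (UorV : forall z, Omega z -> U z \/ V z).
{ intros z Hz.
  destruct (analytic_normal_form Omega f z a Hf Hz)
    as (d & Hd & _ & [Hc|(m & b & K & Hb & HK & HB)]).
  - left. now exists d.
  - right. exists (Rmin d (Cmod b / K)). split.
    + apply Rmin_pos; [exact Hd|].
      apply Rdiv_lt_0_compat; [now apply Cmod_gt_0|exact HK].
    + intros z' Hz' Hne. unfold disk in Hz'.
      generalize (Rmin_l d (Cmod b / K)) (Rmin_r d (Cmod b / K)). intros L1 L2.
      assert (N : (f z' - a)%C <> 0%C).
      { apply leading_term_nonzero with m b (z' - z)%C K; try lra.
        - intros E. apply Hne. replace z' with ((z' - z) + z)%C by ring.
          rewrite E. ring.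
        - apply HB. unfold disk; lra. }
      intros E; apply N; rewrite E; ring. }
destruct (UorV w (HAO w Aw)) as [(d & Hd & H)|HV].
{ now apply H, disk_center. }
exfalso.
destruct (HA U V) as (z & _ & HUz & HVz).
- intros z (d & Hd & H). apply locally_disk. exists d. split; [exact Hd|].
  intros z' Hz'. destruct (sub_disk _ _ _ Hz') as (e & He & Hs).
  exists e; split; auto.
- intros z (d & Hd & H). apply locally_disk. exists d. split; [exact Hd|].
  intros z' Hz'.
  destruct (classic (z' = z)) as [->|Hne]; [now exists d|].
  destruct (sub_disk _ _ _ Hz') as (e & He & Hs).
  assert (HN : 0 < Cmod (z' - z)%C).
  { apply Cmod_gt_0. intros E; apply Hne.
    replace z' with ((z' - z) + z)%C by ring. rewrite E; ring. }
  exists (Rmin e (Cmod (z' - z)%C)). split; [now apply Rmin_pos|].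
  unfold disk; intros u Hu _.
  generalize (Rmin_l e (Cmod (z' - z)%C)) (Rmin_r e (Cmod (z' - z)%C)). intros L1 L2.
  apply H.
  + apply Hs. unfold disk; lra.
  + intros ->. rewrite <- Cmod_opp in Hu.
    replace (- (z - z'))%C with (z' - z)%C in Hu by ring. lra.
- intros z Hz. now apply UorV, HAO.
- now exists z0.
- now exists w.
- now apply (UV z).
Qed.

(** * Roots of unit complex numbers *)

(** By de Moivre's formula it suffices to divide an argument of [w] by [m]. *)
Lemma unit_root (w : C) (m : nat) :
  (1 <= m)%nat -> Cmod w = 1 -> exists u, Cmod u = 1 /\ (u ^ m)%C = w.
Proof.
intros Hm Hw.
assert (E : Re w ^ 2 + Im w ^ 2 = 1).
{ rewrite <- Cmod2_alt, Hw. ring. }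
assert (Hpolar : exists t, w = (cos t, sin t)).
{ assert (B : -1 <= Re w <= 1) by nra.
  assert (S : sqrt (1 - (Re w)²) = Rabs (Im w)).
  { rewrite <- sqrt_Rsqr_abs. f_equal. unfold Rsqr. nra. }
  destruct (Rle_dec 0 (Im w)) as [P|P].
  - exists (acos (Re w)). rewrite cos_acos, sin_acos, S, Rabs_right by lra.
    now destruct w.
  - exists (- acos (Re w)).
    rewrite cos_neg, sin_neg, cos_acos, sin_acos, S, Rabs_left by lra.
    destruct w as [x y]; simpl. now rewrite Ropp_involutive. }
destruct Hpolar as [t ->].
assert (Moivre : forall s n, (((cos s, sin s) : C) ^ n)%C = (cos (INR n * s), sin (INR n * s))).
{ intros s n. induction n as [|n IH].
  - simpl. rewrite Rmult_0_l, cos_0, sin_0. reflexivity.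
  - rewrite Cpow_S, IH, S_INR, Rmult_plus_distr_r, Rmult_1_l, cos_plus, sin_plus.
    unfold Cmult; simpl. f_equal; ring. }
exists (cos (t / INR m), sin (t / INR m)). split.
- unfold Cmod; simpl.
  replace (_ + _) with 1; [apply sqrt_1|].
  generalize (sin2_cos2 (t / INR m)). unfold Rsqr. lra.
- rewrite Moivre.
  replace (INR m * (t / INR m)) with t; [reflexivity|].
  field. apply not_0_INR. lia.
Qed.

(** * First-order behaviour and critical points *)

(** Power series give expansions with a second-order remainder, from which
    derivatives follow alike over the reals (for the partial
    derivatives) and over the complex numbers (for [f] itself). *)
Lemma is_derive_of_quadratic_remainder (K : AbsRing) (V : NormedModule K)
  (f : K -> V) (x : K) (l : V) (M d : R) :
  0 < d ->
  (forall y : K, abs (minus y x) < d ->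
     norm (minus (minus (f y) (f x)) (scal (minus y x) l))
       <= M * abs (minus y x) ^ 2) ->
  is_derive f x l.
Proof.
intros Hd H. split; [apply is_linear_scal_l|].
intros x' Hx' e.
apply (is_filter_lim_locally_unique (V := AbsRing_NormedModule K)) in Hx'.
subst x'.
apply (locally_le_locally_norm (V := AbsRing_NormedModule K)).
assert (P : 0 < Rmin d (e / (Rabs M + 1))).
{ apply Rmin_pos; [exact Hd|].
  apply Rdiv_lt_0_compat; [apply cond_pos|]. generalize (Rabs_pos M); lra. }
exists (mkposreal _ P). intros y Hy.
change (abs (minus y x) < Rmin d (e / (Rabs M + 1))) in Hy.
generalize (Rmin_l d (e / (Rabs M + 1))) (Rmin_r d (e / (Rabs M + 1))); intros L1 L2.
eapply Rle_trans; [exact (H y (Rlt_le_trans _ _ _ Hy L1))|].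
change (M * abs (minus y x) ^ 2 <= e * abs (minus y x)).
generalize (abs_ge_0 (minus y x)) (Rabs_pos M) (Rle_abs M).
set (t := abs (minus y x)) in *. intros T M1 M2.
assert (t * (Rabs M + 1) <= e).
{ apply Rle_trans with (e / (Rabs M + 1) * (Rabs M + 1)).
  - apply Rmult_le_compat_r; lra.
  - right; field; lra. }
assert (M * t <= e) by nra.
simpl. nra.
Qed.

(** Complex differentiability with a quadratic rather than a merely negligible
    remainder, which is what power series provide. *)
Definition first_order_at (f : C -> C) (z0 l : C) : Prop :=
  exists M d, 0 < d /\ forall z, disk z0 d z ->
    Cmod (f z - f z0 - l * (z - z0))%C <= M * Cmod (z - z0)%C ^ 2.

(** At [z0] itself the left-hand side is [f z0 - f z0 - b] if [m = 0], which is
    not zero, whereas the right-hand side is. *)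
Lemma normal_form_exponent_pos (f : C -> C) (z0 b : C) (m : nat) (K d : R) :
  0 < d -> b <> 0%C ->
  (forall z, disk z0 d z ->
     Cmod (f z - f z0 - b * (z - z0) ^ m)%C <= K * Cmod (z - z0)%C ^ S m) ->
  (1 <= m)%nat.
Proof.
intros Hd Hb HB. destruct m as [|m]; [exfalso|lia].
assert (E : (z0 - z0)%C = 0%C) by ring.
assert (H := HB z0). unfold disk in H. rewrite E, Cmod_0 in H. specialize (H Hd).
replace (f z0 - f z0 - b * 0 ^ 0)%C with (- b)%C in H by (simpl; ring).
rewrite Cmod_opp in H. apply Cmod_gt_0 in Hb. simpl in H. lra.
Qed.

(** The derivative is the leading coefficient if the leading exponent is 1, and
    0 if it is larger or if [f] is locally constant. *)
Lemma analytic_first_order (Omega : C -> Prop) (f : C -> C) (z0 : C) :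
  analytic_on Omega f -> Omega z0 -> exists l, first_order_at f z0 l.
Proof.
intros Hf Hz0.
destruct (analytic_normal_form Omega f z0 (f z0) Hf Hz0)
  as (d & Hd & _ & [Hc|(m & b & K & Hb & HK & HB)]).
- exists 0%C, 0, d. split; [exact Hd|]. intros z Hz. rewrite (Hc z Hz).
  replace (f z0 - f z0 - 0 * (z - z0))%C with (RtoC 0) by ring.
  rewrite Cmod_0. lra.
- assert (Hm := normal_form_exponent_pos f z0 b m K d Hd Hb HB).
  destruct (Nat.eq_dec m 1) as [->|Hm1].
  + exists b, K, d. split; [exact Hd|]. intros z Hz.
    generalize (HB z Hz). now rewrite Cpow_1_r.
  + exists 0%C, (K + Cmod b), (Rmin d 1). split; [apply Rmin_pos; lra|].
    intros z Hz. unfold disk in Hz.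
    generalize (Rmin_l d 1) (Rmin_r d 1); intros L1 L2.
    replace (f z - f z0 - 0 * (z - z0))%C
      with ((f z - f z0 - b * (z - z0) ^ m) + b * (z - z0) ^ m)%C by ring.
    eapply Rle_trans; [apply Cmod_triangle|].
    rewrite Cmod_mult, Cmod_pow.
    assert (H := HB z ltac:(unfold disk; lra)).
    set (t := Cmod (z - z0)%C) in *.
    assert (T : 0 <= t) by apply Cmod_ge_0.
    destruct m as [|[|m]]; [lia|lia|].
    assert (P : 0 <= t ^ m <= 1).
    { split; [now apply pow_le|]. rewrite <- (pow1 m). apply pow_incr. lra. }
    assert (P1 : t ^ S (S m) <= t ^ 2) by (simpl; nra).
    assert (P2 : t ^ S (S (S m)) <= t ^ 2).
    { change (t ^ S (S (S m))) with (t * t ^ S (S m)).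
      assert (0 <= t ^ S (S m)) by now apply pow_le. nra. }
    assert (P3 := Cmod_ge_0 b).
    nra.
Qed.

Lemma first_order_is_derive (f : C -> C) (z0 l : C) :
  first_order_at f z0 l ->
  is_derive (K := C_AbsRing) (V := C_NormedModule) f z0 l.
Proof.
intros (M & d & Hd & H).
apply (is_derive_of_quadratic_remainder C_AbsRing C_NormedModule f z0 l M d Hd).
intros z Hz.
change (Cmod (f z - f z0 - (z - z0) * l)%C <= M * Cmod (z - z0)%C ^ 2).
rewrite (Cmult_comm _ l). now apply H.
Qed.

(** A real-linear [p] of norm at most 1 preserves the quadratic remainder; the
    abstraction treats the real and imaginary parts of [f] at once, and [g]
    parametrises a line through [z0]. *)
Lemma is_derive_along_line (f : C -> C) (z0 l u : C) (g : R -> C) (t0 : R)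
  (p : C -> R) :
  first_order_at f z0 l -> Cmod u = 1 ->
  (forall t, (g t - z0)%C = (RtoC (t - t0) * u)%C) ->
  (forall v w, p (v - w)%C = p v - p w) ->
  (forall (s : R) v, p (RtoC s * v)%C = s * p v) ->
  (forall v, Rabs (p v) <= Cmod v) ->
  is_derive (fun t => p (f (g t))) t0 (p (l * u)%C).
Proof.
intros (M & d & Hd & H) Hu Hg Hsub Hscal Hp.
assert (Eg : g t0 = z0).
{ replace (g t0) with ((g t0 - z0) + z0)%C by ring. rewrite Hg.
  replace (t0 - t0) with 0 by ring. ring. }
apply (is_derive_of_quadratic_remainder R_AbsRing R_NormedModule _ _ _ M d Hd).
intros t Ht.
change (Rabs (t - t0) < d) in Ht.
change (Rabs (p (f (g t)) - p (f (g t0)) - (t - t0) * p (l * u)%C)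
          <= M * Rabs (t - t0) ^ 2).
assert (E : Cmod (g t - z0)%C = Rabs (t - t0)).
{ rewrite Hg, Cmod_mult, Cmod_R, Hu. ring. }
rewrite <- Hscal, <- !Hsub, Eg, <- E.
eapply Rle_trans; [apply Hp|].
replace (RtoC (t - t0) * (l * u))%C with (l * (g t - z0))%C by (rewrite Hg; ring).
apply H. unfold disk. now rewrite E.
Qed.

(** The square of the modulus has derivative 0 as well, and that derivative is
    also twice the inner product of [h t0] with [(p, q)]. Squaring avoids the
    square root, which is not differentiable at 0. *)
Lemma is_derive_Cmod_zero (h : R -> C) (t0 p q : R) :
  is_derive (fun t => Re (h t)) t0 p ->
  is_derive (fun t => Im (h t)) t0 q ->
  is_derive (fun t => Cmod (h t)) t0 0 ->
  Re (h t0) * p + Im (h t0) * q = 0.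
Proof.
intros Hp Hq H0.
assert (D1 : is_derive (fun t => Re (h t) ^ 2 + Im (h t) ^ 2) t0
               (INR 2 * p * Re (h t0) ^ 1 + INR 2 * q * Im (h t0) ^ 1)).
{ apply (is_derive_plus (K := R_AbsRing) (V := R_NormedModule));
  now apply is_derive_pow. }
assert (D2 := is_derive_pow _ 2 _ _ H0).
apply (is_derive_ext _ (fun t => Re (h t) ^ 2 + Im (h t) ^ 2)) in D2;
  [|intros t; apply Cmod2_alt].
apply is_derive_unique in D1. apply is_derive_unique in D2.
rewrite D1 in D2. simpl in D2. lra.
Qed.

(** If both partial derivatives of [|f|] vanish, then the vectors [l] and
    [i * l] are both orthogonal to [f z0]; they span the plane unless [l = 0].
    Conversely [| |f z| - |f z0| | <= |f z - f z0|], and the right-hand side is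
    of second order when [l = 0]. *)
Lemma critical_point_modulus (f : C -> C) (z0 l : C) :
  first_order_at f z0 l -> f z0 <> 0%C ->
  (is_critical_point (fun P => Cmod (f P)) z0 <-> l = 0%C).
Proof.
intros Hl Ha. destruct z0 as [x0 y0].
set (gx := fun x : R => (x, y0) : C). set (gy := fun y : R => (x0, y) : C).
assert (Egx : forall x, (gx x - (x0, y0))%C = (RtoC (x - x0) * 1)%C).
{ intros x; unfold gx, Cminus, Cplus, Copp, Cmult, RtoC; simpl. f_equal; ring. }
assert (Egy : forall y, (gy y - (x0, y0))%C = (RtoC (y - y0) * Ci)%C).
{ intros y; unfold gy, Cminus, Cplus, Copp, Cmult, RtoC, Ci; simpl. f_equal; ring. }
split.
- intros [Hx Hy]. simpl in Hx, Hy.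
  assert (HRe : forall u g t0, Cmod u = 1 ->
    (forall t, (g t - (x0, y0))%C = (RtoC (t - t0) * u)%C) ->
    is_derive (fun t => Re (f (g t))) t0 (Re (l * u)%C)).
  { intros u g t0 Hu Hg.
    apply (is_derive_along_line f (x0, y0) l u g t0 Re Hl Hu Hg).
    - reflexivity.
    - intros s v; unfold Re, Im, Cmult, RtoC; simpl; ring.
    - exact re_le_Cmod. }
  assert (HIm : forall u g t0, Cmod u = 1 ->
    (forall t, (g t - (x0, y0))%C = (RtoC (t - t0) * u)%C) ->
    is_derive (fun t => Im (f (g t))) t0 (Im (l * u)%C)).
  { intros u g t0 Hu Hg.
    apply (is_derive_along_line f (x0, y0) l u g t0 Im Hl Hu Hg).
    - reflexivity.
    - intros s v; unfold Re, Im, Cmult, RtoC; simpl; ring.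
    - intros v. eapply Rle_trans; [|apply Rmax_Cmod]. apply Rmax_r. }
  assert (EX := is_derive_Cmod_zero _ _ _ _ (HRe _ _ _ Cmod_1 Egx)
                  (HIm _ _ _ Cmod_1 Egx) Hx).
  assert (EY := is_derive_Cmod_zero _ _ _ _ (HRe _ _ _ Cmod_Ci Egy)
                  (HIm _ _ _ Cmod_Ci Egy) Hy).
  unfold gx in EX; unfold gy in EY. simpl in EX, EY.
  set (a := f (x0, y0)) in *. destruct a as [p q], l as [r s].
  simpl in EX, EY.
  assert (Hpq : 0 < p * p + q * q).
  { apply Cmod_gt_0 in Ha. assert (Q := Cmod2_alt (p, q)). simpl in Q. nra. }
  (* Lagrange's identity |a|^2 |l|^2 = (a . l)^2 + (a x l)^2 *)
  assert (E : (p * p + q * q) * (r * r + s * s) = 0).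
  { replace ((p * p + q * q) * (r * r + s * s))
      with ((p * r + q * s) ^ 2 + (q * r - p * s) ^ 2) by ring.
    replace (p * r + q * s) with 0 by lra. replace (q * r - p * s) with 0 by lra.
    ring. }
  apply Rmult_integral in E. destruct E as [E|E]; [lra|].
  assert (r = 0) by nra. assert (s = 0) by nra. subst. reflexivity.
- intros ->. destruct Hl as (M & d & Hd & H).
  assert (G : forall u g t0, Cmod u = 1 ->
    (forall t, (g t - (x0, y0))%C = (RtoC (t - t0) * u)%C) ->
    is_derive (fun t => Cmod (f (g t))) t0 0).
  { intros u g t0 Hu Hg.
    assert (Eg : g t0 = (x0, y0)).
    { replace (g t0) with ((g t0 - (x0, y0)) + (x0, y0))%C by ring. rewrite Hg.
      replace (t0 - t0) with 0 by ring. ring. }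
    apply (is_derive_of_quadratic_remainder R_AbsRing R_NormedModule _ _ _ M d Hd).
    intros t Ht.
    change (Rabs (t - t0) < d) in Ht.
    change (Rabs (Cmod (f (g t)) - Cmod (f (g t0)) - (t - t0) * 0)
              <= M * Rabs (t - t0) ^ 2).
    assert (E : Cmod (g t - (x0, y0))%C = Rabs (t - t0)).
    { rewrite Hg, Cmod_mult, Cmod_R, Hu. ring. }
    rewrite Eg, Rmult_0_r, Rminus_0_r, <- E.
    assert (B := H (g t)). unfold disk in B. rewrite E in B. specialize (B Ht).
    replace (f (g t) - f (x0, y0) - 0 * (g t - (x0, y0)))%C
      with (f (g t) - f (x0, y0))%C in B by ring.
    rewrite <- E in B.
    eapply Rle_trans; [|exact B].
    assert (T1 := Cmod_triangle (f (g t) - f (x0, y0))%C (f (x0, y0))).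
    assert (T2 := Cmod_triangle (- (f (g t) - f (x0, y0)))%C (f (g t))).
    rewrite Cmod_opp in T2.
    replace (f (g t) - f (x0, y0) + f (x0, y0))%C with (f (g t)) in T1 by ring.
    replace (- (f (g t) - f (x0, y0)) + f (g t))%C with (f (x0, y0)) in T2 by ring.
    apply Rabs_le. lra. }
  split; simpl.
  + exact (G _ _ _ Cmod_1 Egx).
  + exact (G _ _ _ Cmod_Ci Egy).
Qed.

(** * The modulus has no local extremum away from the zeros *)

(** The quantitative part of the open mapping property that is needed: from [a],
    the values of [f] near [z0] move in any prescribed direction [s], with an
    error smaller than the displacement [rho]. Moving from [z0] along an [m]-th
    root [u] of [s * |b| / b] turns the leading term into [t ^ m * |b| * s]. *)
Lemma values_in_every_direction (f : C -> C) (z0 a b s : C) (m : nat) (K d e : R) :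
  (1 <= m)%nat -> b <> 0%C -> 0 < K -> 0 < d ->
  (forall z, disk z0 d z ->
     Cmod (f z - a - b * (z - z0) ^ m)%C <= K * Cmod (z - z0)%C ^ S m) ->
  Cmod s = 1 -> 0 < e ->
  exists z rho, disk z0 e z /\ 0 < rho < e /\ Cmod (f z - a - RtoC rho * s)%C < rho.
Proof.
intros Hm Hb HK Hd HB Hs He.
assert (Nb : 0 < Cmod b) by now apply Cmod_gt_0.
(* b * u ^ m = |b| * s *)
destruct (unit_root (RtoC (Cmod b) / b * s) m Hm) as (u & Hu & Eu).
{ rewrite Cmod_mult, Cmod_div, Cmod_R, Rabs_right, Hs by (trivial; lra). field; lra. }
(* t < |b| / K makes the error smaller than the leading term; t < 1 and
   t < e / |b| make the displacement smaller than e *)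
set (t := Rmin (Rmin d e) (Rmin (Cmod b / K) (Rmin 1 (e / Cmod b))) / 2).
assert (Ht : 0 < t /\ t < d /\ t < e /\ t < Cmod b / K /\ t < 1 /\ t < e / Cmod b).
{ assert (P1 : 0 < Cmod b / K) by now apply Rdiv_lt_0_compat.
  assert (P2 : 0 < e / Cmod b) by now apply Rdiv_lt_0_compat.
  unfold t, Rmin; repeat destruct Rle_dec; lra. }
destruct Ht as (T0 & T1 & T2 & T3 & T4 & T5).
assert (E : (z0 + RtoC t * u - z0)%C = (RtoC t * u)%C) by ring.
assert (EC : Cmod (RtoC t * u)%C = t).
{ rewrite Cmod_mult, Cmod_R, Rabs_right, Hu by lra. ring. }
assert (Tm : 0 < t ^ m) by now apply pow_lt.
exists (z0 + RtoC t * u)%C, (t ^ m * Cmod b). split; [|split; [split|]].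
- unfold disk. now rewrite E, EC.
- now apply Rmult_lt_0_compat.
- assert (t ^ m <= t).
  { destruct m as [|m]; [lia|]. simpl.
    assert (t ^ m <= 1) by (rewrite <- (pow1 m); apply pow_incr; lra).
    assert (0 <= t ^ m) by (apply pow_le; lra). nra. }
  assert (t * Cmod b < e).
  { apply Rmult_lt_compat_r with (r := Cmod b) in T5; [|exact Nb].
    unfold Rdiv in T5; rewrite Rmult_assoc, Rinv_l in T5; lra. }
  nra.
- assert (B := HB (z0 + RtoC t * u)%C). unfold disk in B. rewrite E, EC in B.
  specialize (B T1).
  replace (RtoC (t ^ m * Cmod b) * s)%C with (b * (RtoC t * u) ^ m)%C.
  + eapply Rle_lt_trans; [exact B|]. simpl.
    apply Rmult_lt_compat_r with (r := K) in T3; [|exact HK].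
    unfold Rdiv in T3; rewrite Rmult_assoc, Rinv_l in T3 by lra. nra.
  + rewrite Cpow_mult_l, Eu, RtoC_mult, RtoC_pow. field. exact Hb.
Qed.

(** Moving [f z0] away from the origin along its own ray, respectively towards
    the origin, makes the modulus larger, respectively smaller, at points as
    close to [z0] as desired. *)
Lemma modulus_not_extremal (Omega : C -> Prop) (f : C -> C) (z0 : C) :
  analytic_on Omega f -> Omega z0 ->
  nonconstant_on (connected_component Omega z0) f -> f z0 <> 0%C ->
  ~ (is_local_max Omega (fun P => Cmod (f P)) z0 \/
     is_local_min Omega (fun P => Cmod (f P)) z0).
Proof.
intros Hf Hz0 (w1 & w2 & Hw1 & Hw2 & Hne) Ha.
destruct (analytic_normal_form Omega f z0 (f z0) Hf Hz0)
  as (d & Hd & HO & [Hc|(m & b & K & Hb & HK & HB)]).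
{ exfalso. apply Hne.
  assert (Hconst := locally_constant_component Omega f z0 (f z0) Hf
                      (ex_intro _ d (conj Hd Hc))).
  now rewrite (Hconst w1 Hw1), (Hconst w2 Hw2). }
assert (Hm := normal_form_exponent_pos f z0 b m K d Hd Hb HB).
set (a := f z0) in *.
assert (Na : 0 < Cmod a) by now apply Cmod_gt_0.
assert (Ns : Cmod (a / RtoC (Cmod a))%C = 1).
{ rewrite Cmod_div, Cmod_R, Rabs_right; [field; lra|lra|].
  intros E; injection E; lra. }
assert (Move : forall rho, Cmod (a + RtoC rho * (a / RtoC (Cmod a)))%C
                             = Rabs (Cmod a + rho)).
{ intros rho.
  replace (a + RtoC rho * (a / RtoC (Cmod a)))%C
    with (RtoC (Cmod a + rho) * (a / RtoC (Cmod a)))%C.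
  - rewrite Cmod_mult, Cmod_R, Ns. ring.
  - rewrite RtoC_plus. field. intros E; injection E; lra. }
intros [H|H]; apply (proj1 (locally_disk z0 _)) in H; destruct H as (e & He & H).
- destruct (values_in_every_direction f z0 a b (a / RtoC (Cmod a))%C m K d (Rmin d e))
    as (z & rho & Hz & Hrho & Hv); try assumption; [now apply Rmin_pos|].
  unfold disk in Hz. generalize (Rmin_l d e) (Rmin_r d e); intros L1 L2.
  assert (Hmax := H z ltac:(unfold disk; lra) ltac:(apply HO; unfold disk; lra)).
  fold a in Hmax.
  assert (T := Cmod_triangle (f z) (- (f z - a - RtoC rho * (a / RtoC (Cmod a))))%C).
  rewrite Cmod_opp in T.
  replace (f z + - (f z - a - RtoC rho * (a / RtoC (Cmod a))))%C
    with (a + RtoC rho * (a / RtoC (Cmod a)))%C in T by ring.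
  rewrite Move, Rabs_right in T by lra. lra.
(* rho is also taken below |a|, so that a - rho * a / |a| has modulus |a| - rho *)
- destruct (values_in_every_direction f z0 a b (- (a / RtoC (Cmod a)))%C m K d
              (Rmin (Cmod a) (Rmin d e)))
    as (z & rho & Hz & Hrho & Hv); try assumption.
  { now rewrite Cmod_opp. }
  { repeat apply Rmin_pos; assumption. }
  unfold disk in Hz. generalize (Rmin_l d e) (Rmin_r d e)
    (Rmin_l (Cmod a) (Rmin d e)) (Rmin_r (Cmod a) (Rmin d e)); intros L1 L2 L3 L4.
  assert (Hmin := H z ltac:(unfold disk; lra) ltac:(apply HO; unfold disk; lra)).
  fold a in Hmin.
  assert (T := Cmod_triangle (f z - a - RtoC rho * (- (a / RtoC (Cmod a))))%C
                 (a + RtoC (- rho) * (a / RtoC (Cmod a)))%C).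
  replace (f z - a - RtoC rho * (- (a / RtoC (Cmod a)))
           + (a + RtoC (- rho) * (a / RtoC (Cmod a))))%C with (f z) in T
    by (rewrite RtoC_opp; ring).
  rewrite Move, Rabs_right in T by lra. lra.
Qed.

(** * Saddle points of the modulus *)

Theorem theorem5p5 :
  forall (Omega : C -> Prop) (f : C -> C) (z0 : C) (x0 y0 : R),
    open Omega ->
    analytic_on Omega f ->
    Omega z0 ->
    z0 = (RtoC x0 + Ci * RtoC y0)%C ->
    nonconstant_on (connected_component Omega z0) f ->
    (is_saddle_point Omega (fun P : R * R => Cmod (f P)) (x0, y0)
     <->
     is_derive (K := C_AbsRing) (V := C_NormedModule) f z0 (RtoC 0)
     /\ f z0 <> RtoC 0).
Proof.
intros Omega f z0 x0 y0 _ Hf Hz0 Ez Hnc.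
replace (x0, y0) with z0 by
  (rewrite Ez; unfold Cplus, Cmult, RtoC, Ci; simpl; f_equal; ring).
destruct (analytic_first_order Omega f z0 Hf Hz0) as [l Hl].
assert (Hd := first_order_is_derive f z0 l Hl).
split.
- intros (_ & Hcrit & Hext).
  assert (Ha : f z0 <> RtoC 0).
  { intros E. apply Hext. right.
    apply (proj2 (locally_disk z0 _)). exists 1. split; [lra|].
    intros z _ _. rewrite E, Cmod_0. apply Cmod_ge_0. }
  split; [|exact Ha].
  now rewrite <- (proj1 (critical_point_modulus f z0 l Hl Ha) Hcrit).
- intros [H0 Ha].
  split; [exact Hz0|]. split.
  + apply (critical_point_modulus f z0 l Hl Ha).
    rewrite <- (is_C_derive_unique f z0 l Hd).
    now apply is_C_derive_unique.
  + now apply modulus_not_extremal.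
Qed.
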